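(* Let $(X,\mathcal{K})$ be a pair satisfying assumptions $(A0')$ and $(A1)$. For a function $f:X\rightarrow\overline{\mathcal{K}}$ the following statements are equivalent: 1°. $f$ is topical. 2°. $f(\inf X)=\varepsilon$ and $f^{c(\varphi)}(y)=f(y)^{-1}$ for all $y\in X$. 3°. $f(\inf X)=\varepsilon$ and $f^{c(\varphi)}(y)\leq f(y)^{-1}$ for all $y\in X$. 4°. $f(\inf X)=\varepsilon$ and $f^{c(\psi)}(y,d)=f(y)^{-1}$ for all $y\in X$ and all $d\in\overline{\mathcal{K}}\setminus\{\varepsilon\}$. 5°. $f(\inf X)=\varepsilon$ and $f^{c(\psi)}(y,d)\leq f(y)^{-1}$ for all $y\in X$ and all $d\in\overline{\mathcal{K}}\setminus\{\varepsilon\}$.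
   Context: $(A0')$: $\mathcal{K}=(\mathcal{K},\oplus,\otimes)$ is a $b$-complete idempotent semifield, i.e. a semiring with idempotent addition, with zero $\varepsilon$ (neutral for $\oplus$, absorbing for $\otimes$) and unit $e$, in which every $\mu\neq\varepsilon$ is invertible for $\otimes$, ordered by $\lambda\leq\mu\Leftrightarrow\lambda\oplus\mu=\mu$, such that every subset bounded from above has a supremum (its sum) in $\mathcal{K}$ and $\otimes$ distributes over such suprema (such a $\mathcal{K}$ is commutative); and $X$ is a $b$-complete idempotent semimodule over $\mathcal{K}$: a semimodule with idempotent addition, ordered by $x\leq y\Leftrightarrow x\oplus y=y$, in which every subset bounded from above has a supremum (its sum), and the action $(\lambda,x)\mapsto\lambda x$ distributes over suprema of bounded-above sets of scalars and of vectors. Its zero is $\inf X$; thus $\varepsilon x=\inf X$ for $x\in X$ and $\lambda\inf X=\inf X$ for $\lambda\in\mathcal{K}$. $(A1)$: for all $x\in X$, $y\in X\setminus\{\inf X\}$ the set $\{\lambda\in\mathcal{K}:\lambda y\leq x\}$ is bounded from above in $\mathcal{K}$. It is assumed throughout that $\mathcal{K}$ has no greatest element. Minimal enlargement: $\overline{\mathcal{K}}=\mathcal{K}\cup\{\top\}$, with $\top\notin\mathcal{K}$, $\alpha\leq\top$ and $\alpha\oplus\top=\top$ for all $\alpha\in\overline{\mathcal{K}}$. The product $\otimes$ (also written by concatenation) is extended by $\alpha\otimes\top=\top\otimes\alpha=\top$ for $\alpha\in\overline{\mathcal{K}}\setminus\{\varepsilon\}$ and $\alpha\otimes\varepsilon=\varepsilon\otimes\alpha=\varepsilon$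 for $\alpha\in\overline{\mathcal{K}}$. Conventions: $\varepsilon^{-1}=\top$, $\top^{-1}=\varepsilon$. Suprema and infima of values are taken in $\overline{\mathcal{K}}$. Extended residuation: $x/y:=\sup\{\lambda\in\mathcal{K}:\lambda y\leq x\}\in\overline{\mathcal{K}}$ for all $x,y\in X$ (so $x/\inf X=\top$). A function $f:X\to\overline{\mathcal{K}}$ is topical if it is increasing ($x'\leq x''\Rightarrow f(x')\leq f(x'')$) and homogeneous ($f(\lambda x)=\lambda\otimes f(x)$ for all $x\in X,\lambda\in\mathcal{K}$). Coupling functions: $\varphi(x,y)=x/y$ and $\psi(x,(y,d))=s_{y,d}(x):=\inf\{x/y,d\}$ for $x,y\in X$, $d\in\overline{\mathcal{K}}$. The corresponding Fenchel–Moreau conjugates of $f:X\to\overline{\mathcal{K}}$ are $$f^{c(\varphi)}(y):=\sup_{x\in X}f(x)^{-1}\otimes(x/y),\qquad f^{c(\psi)}(y,d):=\sup_{x\in X}f(x)^{-1}\otimes s_{y,d}(x),\qquad y\in X,\ d\in\overline{\mathcal{K}}.$$ *)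

(* Defs.v *)
From mathcomp Require Import all_boot all_order all_algebra.
From mathcomp Require Import boolp classical_sets.

Set Implicit Arguments.
Unset Strict Implicit.
Unset Printing Implicit Defensive.

Import GRing.Theory.
Local Open Scope classical_set_scope.
Local Open Scope ring_scope.

(* Idempotent semirings and semimodules are written additively: on K,        *)
(* [+] is the idempotent addition, [*] the product, [0] is epsilon and [1]   *)
(* is e. On X, [0] is the zero of the semimodule, which is inf X (lemma      *)
(* [le_idem0]). Neither the product of K nor any order is assumed to be      *)
(* commutative, respectively total.                                          *)

Section OrderBounds.
Variables (T : Type) (R : T -> T -> Prop).

Definition is_ub (A : set T) (u : T) : Prop := forall a, A a -> R a u.

Definition is_lub (A : set T) (s : T) : Prop :=
  is_ub A s /\ forall u, is_ub A u -> R s u.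

Definition bounded_above (A : set T) : Prop := exists u, is_ub A u.

End OrderBounds.

Definition is_glb (T : Type) (R : T -> T -> Prop) : set T -> T -> Prop :=
  is_lub (fun x y => R y x).

Definition le_idem (M : nmodType) (x y : M) : Prop := x + y = y.

Definition idempotent_add (M : nmodType) : Prop := forall x : M, x + x = x.

Definition b_complete (M : nmodType) : Prop :=
  forall A : set M, bounded_above (@le_idem M) A ->
    exists s, is_lub (@le_idem M) A s.

Definition is_inverse (K : pzSemiRingType) (m u : K) : Prop :=
  m * u = 1 /\ u * m = 1.

Record b_complete_idempotent_semifield (K : pzSemiRingType) : Prop := {
  semifield_idem : idempotent_add K;
  semifield_inv : forall m : K, m != 0 -> exists u, is_inverse m u;
  semifield_bcomplete : b_complete K;
  semifield_mul_supl : forall (A : set K) (s l : K),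
    is_lub (@le_idem K) A s ->
    is_lub (@le_idem K) [set l * a | a in A] (l * s);
  semifield_mul_supr : forall (A : set K) (s l : K),
    is_lub (@le_idem K) A s ->
    is_lub (@le_idem K) [set a * l | a in A] (s * l)
}.

Record b_complete_idempotent_semimodule (K : pzSemiRingType)
    (X : lSemiModType K) : Prop := {
  semimodule_idem : idempotent_add X;
  semimodule_bcomplete : b_complete X;
  semimodule_scale_supl : forall (A : set K) (s : K) (x : X),
    is_lub (@le_idem K) A s ->
    is_lub (@le_idem X) [set a *: x | a in A] (s *: x);
  semimodule_scale_supr : forall (B : set X) (t : X) (l : K),
    is_lub (@le_idem X) B t ->
    is_lub (@le_idem X) [set l *: b | b in B] (l *: t)
}.

Definition assumption_A0' (K : pzSemiRingType) (X : lSemiModType K) : Prop :=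
  b_complete_idempotent_semifield K /\ b_complete_idempotent_semimodule X.

Definition assumption_A1 (K : pzSemiRingType) (X : lSemiModType K) : Prop :=
  forall x y : X, y != 0 ->
    bounded_above (@le_idem K) [set l : K | le_idem (l *: y) x].

Definition no_greatest (K : pzSemiRingType) : Prop :=
  ~ exists g : K, forall l : K, le_idem l g.

(* The minimal enlargement of K: [None] is the adjoined top element. *)
Definition Kbar (K : pzSemiRingType) : choiceType := option K.

Section Enlargement.
Variable K : pzSemiRingType.

Definition fin (l : K) : Kbar K := Some l.
Definition top : Kbar K := None.
Definition eps : Kbar K := fin 0.

Definition le_bar (a b : Kbar K) : Prop :=
  match a, b with
  | _, None => True
  | None, Some _ => False
  | Some l, Some m => le_idem l m
  end.

Definition mul_bar (a b : Kbar K) : Kbar K :=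
  match a, b with
  | Some l, Some m => fin (l * m)
  | Some l, None => if l == 0 then eps else top
  | None, Some m => if m == 0 then eps else top
  | None, None => top
  end.

Definition inv_bar (a : Kbar K) : Kbar K :=
  match a with
  | None => eps
  | Some l => if l == 0 then top else fin (xget 0 [set u | is_inverse l u])
  end.

(* The default values of [xget] are never used when K is b-complete, see     *)
(* [sup_barP] and [inf_barP].                                                *)
Definition sup_bar (A : set (Kbar K)) : Kbar K :=
  xget top [set s | is_lub le_bar A s].

Definition inf_bar (A : set (Kbar K)) : Kbar K :=
  xget eps [set s | is_glb le_bar A s].

End Enlargement.

Arguments top {K}.
Arguments eps {K}.

Section Topical.
Variables (K : pzSemiRingType) (X : lSemiModType K).

Definition residual (x y : X) : Kbar K :=
  sup_bar [set fin l | l in [set l : K | le_idem (l *: y) x]].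

Definition topical (f : X -> Kbar K) : Prop :=
  (forall x' x'' : X, le_idem x' x'' -> le_bar (f x') (f x'')) /\
  (forall (x : X) (l : K), f (l *: x) = mul_bar (fin l) (f x)).

Definition coupling_phi (x y : X) : Kbar K := residual x y.

Definition coupling_psi (x : X) (yd : X * Kbar K) : Kbar K :=
  inf_bar [set residual x yd.1; yd.2].

Definition conjugate (Y : Type) (c : X -> Y -> Kbar K) (f : X -> Kbar K)
    (y : Y) : Kbar K :=
  sup_bar [set mul_bar (inv_bar (f x)) (c x y) | x in [set: X]].

End Topical.

Lemma le_idem0 (M : nmodType) (x : M) : le_idem 0 x.
Proof. exact: add0r. Qed.

Lemma inv_barP (K : pzSemiRingType) (l : K) :
  b_complete_idempotent_semifield K -> l != 0 ->
  exists2 u, inv_bar (fin l) = fin u & is_inverse l u.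
Proof.
move=> HK l0; rewrite /= (negbTE l0); eexists; first by [].
exact: (xgetPex 0 (semifield_inv HK l0)).
Qed.

Lemma sup_barP (K : pzSemiRingType) (A : set (Kbar K)) :
  b_complete_idempotent_semifield K -> is_lub (@le_bar K) A (sup_bar A).
Proof.
move=> HK; apply: (xgetPex top); rewrite /=.
have [[u uA]|nub] := pselect (exists u : K, is_ub (@le_bar K) A (fin u)).
  have [|s [sub sle]] := semifield_bcomplete HK (A := [set l | A (fin l)]).
    by exists u => l /uA.
  exists (fin s); split=> [[l|] // Al|[v|] // vA]; first exact: sub.
    by have := uA _ Al.
  by apply: sle => l /vA.
exists top; split=> [[]//|[v|] // vA].
by apply: nub; exists v.
Qed.

Lemma inf_barP (K : pzSemiRingType) (A : set (Kbar K)) :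
  b_complete_idempotent_semifield K -> is_glb (@le_bar K) A (inf_bar A).
Proof.
move=> HK; apply: (xgetPex eps); rewrite /=.
have [sub sle] := sup_barP [set b | is_ub (fun x y => le_bar y x) A b] HK.
exists (sup_bar [set b | is_ub (fun x y => le_bar y x) A b]); split.
  by move=> a Aa; apply: sle => b; apply.
by move=> b bA; apply: sub.
Qed.

(* Main.v *)
Require Import Defs.
From mathcomp Require Import all_boot all_order all_algebra.
From mathcomp Require Import boolp classical_sets.

(* By (A1), [x / y] is finite for [y <> inf X] and the supremum defining it   *)
(* is attained, so [l <= x / y] iff [l y <= x]. On the other hand, for [l] in *)
(* K and p, q in the enlargement, [p^-1 l <= q^-1] iff [l q <= p]. Together   *)
(* they turn the conjugate inequality at y into: [l y <= x] implies           *)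
(* [l (f y) <= f x]; this amounts to topicality. Equality is reached at x = y *)
(* for phi, and at x = d y for psi; d = top reduces psi to phi.               *)

Set Implicit Arguments.
Unset Strict Implicit.
Unset Printing Implicit Defensive.

Import GRing.Theory.
Local Open Scope classical_set_scope.
Local Open Scope ring_scope.

(** Two adjunctions carry the argument: [le_residual] for the action on X and [le_mul_inv_bar] for
    inversion in the enlargement. [conjugate_phi_le_topical] recovers topicality from the inequality
    for phi, and [topical_conjugate_psi] gives equality for psi at every level [d] other than [eps].
    The level [top] carries both results between psi and phi, so that the five statements close into
    a cycle. *)

Section IdempotentOrder.
Variable M : nmodType.

Lemma le_idem_trans (x y z : M) : le_idem x y -> le_idem y z -> le_idem x z.
Proof. by rewrite /le_idem => xy yz; rewrite -yz addrA xy. Qed.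

Lemma le_idem_anti (x y : M) : le_idem x y -> le_idem y x -> x = y.
Proof. by rewrite /le_idem addrC => -> ->. Qed.

End IdempotentOrder.

Lemma le_idem_mul2l (K : pzSemiRingType) (c a b : K) :
  le_idem a b -> le_idem (c * a) (c * b).
Proof. by rewrite /le_idem -mulrDr => ->. Qed.

Lemma le_idem_mul2r (K : pzSemiRingType) (c a b : K) :
  le_idem a b -> le_idem (a * c) (b * c).
Proof. by rewrite /le_idem -mulrDl => ->. Qed.

Lemma le_idem_scale2r (K : pzSemiRingType) (X : lSemiModType K) (x : X)
    (a b : K) :
  le_idem a b -> le_idem (a *: x) (b *: x).
Proof. by rewrite /le_idem -scalerDl => ->. Qed.

(** If 1 = 0, then K reduces to 0, which is its greatest element. *)
Lemma no_greatest_oner_neq0 (K : pzSemiRingType) : no_greatest K -> 1 != 0 :> K.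
Proof.
move=> htop; apply/eqP => K10; apply: htop; exists 0 => l.
by rewrite -[l]mul1r K10 mul0r; apply: le_idem0.
Qed.

(** * Order, product and inversion in the minimal enlargement *)

Section Enlargement.
Variable K : pzSemiRingType.
Variable HK : b_complete_idempotent_semifield K.

Lemma le_bar_refl (a : Kbar K) : le_bar a a.
Proof. by case: a => [l|] //=; apply: (semifield_idem HK). Qed.

Lemma le_bar_trans (a b c : Kbar K) : le_bar a b -> le_bar b c -> le_bar a c.
Proof. by case: a b c => [a|] [b|] [c|] //=; apply: le_idem_trans. Qed.

Lemma le_bar_anti (a b : Kbar K) : le_bar a b -> le_bar b a -> a = b.
Proof. by case: a b => [a|] [b|] //= ab ba; rewrite (le_idem_anti ab ba). Qed.

Lemma le_eps (a : Kbar K) : le_bar eps a.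
Proof. by case: a => //= l; apply: le_idem0. Qed.

Lemma le_top (a : Kbar K) : le_bar a top.
Proof. by case: a. Qed.

Lemma le_idem_eq0 (a : K) : le_idem a 0 -> a = 0.
Proof. by move=> a0; apply: le_idem_anti a0 (le_idem0 _). Qed.

Lemma mul_bar_le2l (a b c : Kbar K) :
  le_bar a b -> le_bar (mul_bar c a) (mul_bar c b).
Proof.
case: a b c => [a|] [b|] [c|] ab //; rewrite /mul_bar.
- exact: le_idem_mul2l.
- have [b0|b0] := eqVneq b 0; last exact: le_top.
  by move: ab; rewrite b0 => /le_idem_eq0 ->; rewrite eqxx; apply: le_bar_refl.
- have [->|c0] := eqVneq c 0; last exact: le_top.
  by rewrite mul0r; apply: le_idem0.
- exact: le_top.
- exact: le_bar_refl.
Qed.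

Lemma sup_bar_le (A : set (Kbar K)) (u : Kbar K) :
  le_bar (sup_bar A) u <-> forall a, A a -> le_bar a u.
Proof.
have [ub least] := @sup_barP _ A HK; split=> [Au a Aa|]; last exact: least.
exact: le_bar_trans (ub _ Aa) Au.
Qed.

Lemma le_inf_bar2 (a b c : Kbar K) :
  le_bar c (inf_bar [set a; b]) <-> le_bar c a /\ le_bar c b.
Proof.
have [lb greatest] := inf_barP [set a; b] HK; split=> [cab|[ca cb]].
  by split; apply: le_bar_trans cab (lb _ _); [left|right].
by apply: greatest => _ [] ->.
Qed.

Lemma inverse_neq0 (l u : K) : 1 != 0 :> K -> is_inverse l u -> u != 0.
Proof.
by move=> K1 [lu _]; apply: contraNneq K1 => u0; rewrite -lu u0 mulr0.
Qed.

(* The product p^-1 l is kept on this side since the commutativity of K is   *)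
(* not available.                                                            *)
Lemma le_mul_inv_bar (l : K) (p q : Kbar K) : 1 != 0 :> K ->
  le_bar (mul_bar (inv_bar p) (fin l)) (inv_bar q) <->
  le_bar (mul_bar (fin l) q) p.
Proof.
move=> K1; have [->|l0] := eqVneq l 0.
  have e1 : mul_bar (inv_bar p) (fin 0) = eps :> Kbar K.
    by case: (inv_bar p) => [a|] /=; rewrite ?mulr0 ?eqxx.
  have e2 : mul_bar (fin 0) q = eps :> Kbar K.
    by case: q => [a|] /=; rewrite ?mul0r ?eqxx.
  by rewrite e1 e2; split=> _; apply: le_eps.
case: p => [a|]; last first.
  split=> _; first exact: le_top.
  by rewrite /= mul0r; apply: le_eps.
(* For [p = eps] the left product is [top], and both sides say that [q = eps]. *)
have [->|a0] := eqVneq a 0.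
  rewrite [inv_bar (Some 0)]/= eqxx [mul_bar _ (fin l)]/= (negbTE l0).
  case: q => [b|]; last by rewrite /= (negbTE l0).
  have [->|b0] := eqVneq b 0.
    by rewrite /= eqxx mulr0; split=> // _; apply: le_idem0.
  have [v -> [bv vb]] := inv_barP HK b0; split=> //= /le_idem_eq0 lb0.
  by case/eqP: l0; rewrite -[l]mulr1 -bv mulrA lb0 mul0r.
have [u -> [au ua]] := inv_barP HK a0.
(* For [q = top] both sides fail, since [l] and [a] are nonzero. *)
case: q => [b|]; last first.
  rewrite /= (negbTE l0); split=> // /le_idem_eq0 ul0.
  by case/eqP: l0; rewrite -[l]mul1r -au -mulrA ul0 mulr0.
have [->|b0] := eqVneq b 0.
  by rewrite /= eqxx mulr0; split=> // _; apply: le_idem0.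
(* Multiply on the left by [a] and on the right by [b], or by their inverses to return. *)
have [v -> [bv vb]] := inv_barP HK b0; rewrite /=; split.
  move=> /(le_idem_mul2l a) /(le_idem_mul2r b).
  by rewrite mulrA au mul1r -mulrA vb mulr1.
move=> /(le_idem_mul2l u) /(le_idem_mul2r v).
by rewrite ua mul1r -!mulrA bv mulr1.
Qed.

(** Inversion reverses products, and the order of factors is kept as K need not commute. *)
Lemma inv_bar_mul_bar (l u : K) (q : Kbar K) : 1 != 0 :> K ->
  is_inverse l u -> inv_bar (mul_bar (fin l) q) = mul_bar (inv_bar q) (fin u).
Proof.
move=> K1 lu; have u0 := inverse_neq0 K1 lu.
have l0 : l != 0 by apply: (@inverse_neq0 u) => //; case: lu.
case: q => [b|]; last by rewrite /= (negbTE l0) /= mul0r.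
have [->|b0] := eqVneq b 0; first by rewrite /= mulr0 eqxx /= (negbTE u0).
have [v -> [bv vb]] := inv_barP HK b0; case: lu => lu ul.
have lb0 : l * b != 0.
  by apply: contraNneq b0 => lb0; rewrite -[b]mul1r -ul -mulrA lb0 mulr0.
have [w -> [lbw wlb]] := inv_barP HK lb0; congr fin.
(* Uniqueness of the inverse: [w = w (l b) (v u) = v u]. *)
by rewrite -[w]mulr1 -lu -[l]mulr1 -bv !mulrA -(mulrA w) wlb mul1r.
Qed.

End Enlargement.

(** * Residuation, conjugates and topical functions *)

Section Topical.
Variables (K : pzSemiRingType) (X : lSemiModType K).
Variables (hA0 : assumption_A0' X) (hA1 : assumption_A1 X).
Variable K1 : 1 != 0 :> K.

Let HK : b_complete_idempotent_semifield K := proj1 hA0.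
Let HX : b_complete_idempotent_semimodule X := proj2 hA0.

Lemma scale_le_residual (l : K) (x y : X) :
  le_idem (l *: y) x -> le_bar (fin l) (residual x y).
Proof.
by move=> lyx; apply: (proj1 (sup_barP _ HK)); exists l.
Qed.

(** (A1) and b-completeness give a supremum [s] in K of the scalars [l] with [l y <= x]. As the
    action distributes over it, [s y] is the supremum of the vectors [l y], hence below [x]. *)
Lemma residual_attained (x y : X) : y != 0 ->
  exists2 s, residual x y = fin s & le_idem (s *: y) x.
Proof.
move=> y0; have [s [sub sle]] := semifield_bcomplete HK (hA1 x y0).
exists s.
  apply: le_bar_anti.
    by apply/(sup_bar_le HK) => _ [l lyx <-]; apply: sub.
  (* A finite residual is an upper bound of those scalars, hence above [s]; [top] is above
     anything. *)
  case: (residual x y) (fun l => @scale_le_residual l x y) => [r|] // ub.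
  by apply: sle => l; apply: ub.
have [_] := semimodule_scale_supl HX y (conj sub sle).
by apply=> _ [l lyx <-].
Qed.

Lemma le_residual (l : K) (x y : X) :
  le_bar (fin l) (residual x y) <-> le_idem (l *: y) x.
Proof.
split; last exact: scale_le_residual.
have [->|y0] := eqVneq y 0; first by rewrite scaler0 => _; apply: le_idem0.
have [s -> syx] := residual_attained x y0.
by move=> /(le_idem_scale2r y) lsy; apply: le_idem_trans lsy syx.
Qed.

Lemma conjugate_le (Y : Type) (c : X -> Y -> Kbar K) (f : X -> Kbar K) (y : Y)
    (u : Kbar K) :
  le_bar (conjugate c f y) u <->
  forall x, le_bar (mul_bar (inv_bar (f x)) (c x y)) u.
Proof.
rewrite (sup_bar_le HK); split=> [h x|h _ [x _ <-]] //.
by apply: h; exists x.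
Qed.

Variable f : X -> Kbar K.

(** Homogeneity at the scalar 0 suffices, because [eps] absorbs even [top]. *)
Lemma topical0 : topical f -> f 0 = eps.
Proof.
move=> [_ /(_ 0 0)]; rewrite scale0r => ->.
by case: (f 0) => [a|] /=; rewrite ?mul0r ?eqxx.
Qed.

Lemma topical_conjugate_phi_le (y : X) : topical f ->
  le_bar (conjugate (@coupling_phi K X) f y) (inv_bar (f y)).
Proof.
move=> ftop; apply/conjugate_le => x; rewrite /coupling_phi.
have [->|y0] := eqVneq y 0; first by rewrite topical0 //= eqxx; apply: le_top.
have [s -> syx] := residual_attained x y0.
apply/(le_mul_inv_bar HK) => //; case: ftop => fmono fhom.
by rewrite -fhom; apply: fmono.
Qed.

Lemma conjugate_phi_le_topical : f 0 = eps ->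
  (forall y, le_bar (conjugate (@coupling_phi K X) f y) (inv_bar (f y))) ->
  topical f.
Proof.
move=> f0 fle.
(* The core inequality: [l = 1] yields monotonicity, while [l] and its inverse yield the two halves
   of homogeneity. *)
have subhom l x y : le_idem (l *: y) x -> le_bar (mul_bar (fin l) (f y)) (f x).
  move=> /le_residual lxy; apply/(le_mul_inv_bar HK) => //.
  have /conjugate_le/(_ x) := fle y.
  by apply: le_bar_trans; apply: mul_bar_le2l.
have mul1bar (a : Kbar K) : mul_bar (fin 1) a = a.
  by case: a => [a|] /=; rewrite ?mul1r ?(negbTE K1).
split=> [y x yx|y l].
  by rewrite -[f y]mul1bar; apply: subhom; rewrite scale1r.
have [->|l0] := eqVneq l 0.
  by rewrite scale0r f0; case: (f y) => [a|] /=; rewrite ?mul0r ?eqxx.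
(* The upper bound for [f (l y)]: apply [subhom] with [u] to [u (l y) = y], then multiply by [l]. *)
have [u lu] := semifield_inv HK l0; have u0 := inverse_neq0 K1 lu.
apply: le_bar_anti; last by apply: subhom; apply: (semimodule_idem HX).
have : le_bar (mul_bar (fin u) (f (l *: y))) (f y).
  apply: subhom; rewrite scalerA; case: lu => _ ->.
  by rewrite scale1r; apply: (semimodule_idem HX).
move=> /(mul_bar_le2l HK (fin l)); case: lu => lu _.
case: (f (l *: y)) => [a|] /=; first by rewrite mulrA lu mul1r.
by rewrite (negbTE u0) /= (negbTE l0).
Qed.

Lemma coupling_psi_top (x y : X) : coupling_psi x (y, top) = residual x y.
Proof.
apply: le_bar_anti.
  by have /(le_inf_bar2 HK)[] := le_bar_refl HK (coupling_psi x (y, top)).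
by apply/(le_inf_bar2 HK); split; [apply: le_bar_refl | apply: le_top].
Qed.

Lemma conjugate_psi_top (y : X) :
  conjugate (@coupling_psi K X) f (y, top) = conjugate (@coupling_phi K X) f y.
Proof.
by congr sup_bar; apply: eq_imagel => x _; rewrite coupling_psi_top.
Qed.

Lemma conjugate_psi_le_phi (y : X) (d : Kbar K) :
  le_bar (conjugate (@coupling_psi K X) f (y, d))
         (conjugate (@coupling_phi K X) f y).
Proof.
apply/conjugate_le => x.
have /conjugate_le/(_ x) :=
  le_bar_refl HK (conjugate (@coupling_phi K X) f y).
apply: le_bar_trans; apply: mul_bar_le2l => //.
by have /(le_inf_bar2 HK)[] := le_bar_refl HK (coupling_psi x (y, d)).
Qed.

Lemma topical_conjugate_psi (y : X) (d : Kbar K) : topical f -> d <> eps ->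
  conjugate (@coupling_psi K X) f (y, d) = inv_bar (f y).
Proof.
move=> ftop d0; apply: le_bar_anti.
  exact: le_bar_trans (conjugate_psi_le_phi y d)
    (topical_conjugate_phi_le y ftop).
(* A nonzero finite scalar below [d]: [d] itself, or 1 when [d = top]. *)
have [l l0 ld] : exists2 l, l != 0 & le_bar (fin l) d.
  case: d d0 => [l|] d0; last by exists 1.
  exists l; last exact: (le_bar_refl HK (fin l)).
  by apply/eqP => l0; apply: d0; rewrite l0.
have [u lu] := semifield_inv HK l0.
(* The term at [x = l y] already reaches the bound: there psi is at least [l], and
   [f (l y)^-1 l = f(y)^-1 u l = f(y)^-1]. *)
have /conjugate_le/(_ (l *: y)) :=
  le_bar_refl HK (conjugate (@coupling_psi K X) f (y, d)).
apply: le_bar_trans; apply: (@le_bar_trans _ _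
  (mul_bar (inv_bar (f (l *: y))) (fin l))); last first.
  apply: mul_bar_le2l => //; apply/(le_inf_bar2 HK); split=> //=.
  by apply/le_residual; apply: (semimodule_idem HX).
rewrite (proj2 ftop) (inv_bar_mul_bar HK _ K1 lu).
have u0 := inverse_neq0 K1 lu; case: lu => _ ul.
case: (inv_bar (f y)) => [a|] /=.
  by rewrite -mulrA ul mulr1; apply: (semifield_idem HK).
by rewrite (negbTE u0) /= (negbTE l0).
Qed.

Lemma topical_conjugate_phi (y : X) : topical f ->
  conjugate (@coupling_phi K X) f y = inv_bar (f y).
Proof. by move=> ftop; rewrite -conjugate_psi_top topical_conjugate_psi. Qed.

End Topical.

Theorem theorem30 (K : pzSemiRingType) (X : lSemiModType K)
    (hA0 : assumption_A0' X) (hA1 : assumption_A1 X) (htop : no_greatest K)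
    (f : X -> Kbar K) :
  [<-> topical f;
       f 0 = eps /\
         forall y : X, conjugate (@coupling_phi K X) f y = inv_bar (f y);
       f 0 = eps /\
         forall y : X,
           le_bar (conjugate (@coupling_phi K X) f y) (inv_bar (f y));
       f 0 = eps /\
         forall (y : X) (d : Kbar K), d <> eps ->
           conjugate (@coupling_psi K X) f (y, d) = inv_bar (f y);
       f 0 = eps /\
         forall (y : X) (d : Kbar K), d <> eps ->
           le_bar (conjugate (@coupling_psi K X) f (y, d)) (inv_bar (f y))].
Proof.
have K1 := no_greatest_oner_neq0 htop; have HK := proj1 hA0.
tfae.
- move=> ftop; split=> [|y]; first exact: topical0.
  exact: topical_conjugate_phi.
- by case=> f0 fE; split=> // y; rewrite fE; apply: le_bar_refl.
(* The passage from phi to psi goes through topicality. *)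
- case=> f0 fle; split=> // y d d0; apply: topical_conjugate_psi => //.
  exact: conjugate_phi_le_topical.
- by case=> f0 fE; split=> // y d d0; rewrite fE //; apply: le_bar_refl.
- case=> f0 fle; apply: conjugate_phi_le_topical => // y.
  by rewrite -conjugate_psi_top //; apply: fle.
Qed.
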